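(* Let $(V,\rho,\cdot,\langle\cdot,\cdot\rangle,D)$ be a non asymmetric Courant algebroid on a connected smooth manifold $M$. If its rank is greater than two, then the anchor map $\rho$ satisfies $$[\rho(s),\rho(s')]=\rho(ss')-\rho(s's)\qquad\text{for all } s,s'\in\Gamma(V).$$
   Context: $M$ is a connected smooth manifold, $F(M)=C^\infty(M,\mathbb R)$, $V$ is a smooth real vector bundle on $M$, and $\Gamma(V)$ is its space of smooth sections. An anchored almost algebroid $(V,\rho,\cdot)$ on $M$ consists of $V$, a vector bundle morphism $\rho:V\to TM$ over the identity of $M$ (the anchor; the induced $F(M)$-linear map $\Gamma(V)\to\Gamma(TM)$ is also denoted $\rho$), and an $\mathbb R$-bilinear multiplication $(s,s')\mapsto ss'=s\cdot s'$ on $\Gamma(V)$ (not assumed skew symmetric). Its associator is $(s,s',s'')=s(s's'')-(ss')s''$. $C^1(F(M),V)$ is the space of $\mathbb R$-linear maps $F(M)\to\Gamma(V)$; $D\in C^1(F(M),V)$ is a 1-cocycle if $D(fg)=fD(g)+gD(f)$ for all $f,g\in F(M)$. A non asymmetric Courant algebroid $(V,\rho,\cdot,\langle\cdot,\cdot\rangle,D)$ is an anchored almost algebroid $(V,\rho,\cdot)$ with a (smooth, fiberwise) non degenerate symmetric bilinear form $\langle\cdot,\cdot\rangle$ on $V$ and a 1-cocycle $D\in C^1(F(M),V)$ such that for all $s,s',s''\in\Gamma(V)$, $f\in F(M)$: (R1) $(s,s',s'')-(s',s,s'')=D\big(\delta\langle\cdot,\cdot\rangle(s,s',s'')\big)$;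 (R2) $(fs)s'=f(ss')$; (R3) $\rho(s)\langle s',s''\rangle=\langle ss'+D(\langle s,s'\rangle),s''\rangle+\langle s',ss''+D(\langle s,s''\rangle)\rangle$; where $$\delta\langle\cdot,\cdot\rangle(s,s',s'')=-\rho(s)\langle s',s''\rangle+\langle ss',s''\rangle+\langle s',ss''\rangle+\rho(s')\langle s,s''\rangle-\langle s's,s''\rangle-\langle s,s's''\rangle .$$ Its rank is the rank of $V$. *)

(* Defs.v *)
From HB Require Import structures.
From mathcomp Require Import all_boot all_order all_algebra.
From mathcomp Require Import all_classical all_reals.
From mathcomp Require Import topology normedtype landau derive.

Set Implicit Arguments.
Unset Strict Implicit.
Unset Printing Implicit Defensive.
Import Order.TTheory GRing.Theory Num.Theory.
Import numFieldNormedType.Exports.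
Local Open Scope classical_set_scope.
Local Open Scope ring_scope.

Section Ck.
Context {R : realType}.
Implicit Types V W : normedModType R.

(* The usual C^k when U is open: f is differentiable on U and each
   directional derivative is C^(k-1). *)
Fixpoint Ck V W (k : nat) (U : set V) (f : V -> W) : Prop :=
  match k with
  | 0 => forall x, U x -> {for x, continuous f}
  | k'.+1 => (forall x, U x -> differentiable f x) /\
             (forall v, Ck k' U ('D_v f))
  end.

Definition smooth V W (U : set V) (f : V -> W) := forall k, Ck k U f.

Lemma near_eq_differentiable V W (f g : V -> W) (x : V) :
  (\near x, f x = g x) -> differentiable f x -> differentiable g x.
Proof.
move=> fg df.
have gE : g \o shift x = cst (g x) + 'd f x +o_ (0 : V) id.
  apply/eqaddoP => e e0.
  have /eqaddoP/(_ _ e0) := diff_locally df.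
  have fgx : f x = g x by apply: nbhs_singleton fg.
  have : \forall h \near (0 : V), f (h + x) = g (h + x).
    have : shift x h @[h --> (0 : V)] --> x.
      by rewrite -[X in _ --> X]add0r; apply: cvgD; [exact: cvg_id | exact: cvg_cst].
    by move=> /(_ _ fg).
  apply: filterS2 => h.
  by rewrite /= !fctE /= => -> ; rewrite fgx.
have dE := diff_unique (diff_continuous df) gE.
apply/diff_locallyP; rewrite dE; split => //.
exact: diff_continuous.
Qed.

Lemma Ck_local V W k (U : set V) (f g : V -> W) :
  (forall x, U x -> exists2 A : set V, open A & A x /\
     Ck k A f /\ forall y, A y -> f y = g y) -> Ck k U g.
Proof.
elim: k f g => [|k IHk] f g H /=.
  move=> x /H [A oA [Ax [cf fg]]].
  have nA : \near x, f x = g x.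
    by have : nbhs x A by [apply: open_nbhs_nbhs]; exact: filterS.
  rewrite /prop_for /continuous_at -(fg _ Ax).
  by apply: cvg_trans (cf _ Ax); apply: near_eq_cvg; apply: filterS nA.
split=> [x /H [A oA [Ax [[df _] fg]]]|v].
  apply: near_eq_differentiable (df _ Ax).
  have : nbhs x A by apply: open_nbhs_nbhs.
  exact: filterS.
apply: (IHk ('D_v f)) => x /H [A oA [Ax [[_ df] fg]]].
exists A => //; split=> //; split=> [|y Ay]; first exact: df.
apply: near_eq_derive.
have : nbhs y A by apply: open_nbhs_nbhs.
exact: filterS.
Qed.

Lemma Ck_ext V W k (U : set V) (f g : V -> W) : open U ->
  (forall x, U x -> f x = g x) -> Ck k U f -> Ck k U g.
Proof.
move=> oU fg Cf; apply: (@Ck_local _ _ _ _ f) => x Ux.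
by exists U.
Qed.

Lemma Ck_sub V W k (U A : set V) (f : V -> W) : A `<=` U -> Ck k U f -> Ck k A f.
Proof.
move=> AU; elim: k f => [|k IHk] f /= Cf; first by move=> x /AU/Cf.
by case: Cf => df Cf; split=> [x /AU/df //|v]; apply: IHk.
Qed.

Lemma CkW V W k (U : set V) (f : V -> W) : Ck k.+1 U f -> Ck k U f.
Proof.
elim: k f => [|k IHk] f [df Cf].
  by move=> x /df/differentiable_continuous.
by split=> // v; apply: IHk.
Qed.

Lemma Ck_cst V W k (U : set V) (w : W) : Ck k U (cst w : V -> W).
Proof.
elim: k w => [|k IHk] w /=; first by move=> x _; exact: cvg_cst.
split=> [x _|v]; first exact: differentiable_cst.
rewrite (_ : 'D_v (cst w) = cst 0) //.
by apply/funext => x; rewrite derive_cst.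
Qed.

Lemma CkD V W k (U : set V) (f g : V -> W) : open U ->
  Ck k U f -> Ck k U g -> Ck k U (fun x => f x + g x).
Proof.
move=> oU; elim: k f g => [|k IHk] f g.
  by move=> cf cg x Ux; apply: cvgD; [exact: cf | exact: cg].
move=> [df Cf] [dg Cg]; split=> [x Ux|v].
  by apply: (@differentiableD _ _ _ f g); [exact: df | exact: dg].
apply: Ck_ext (IHk _ _ (Cf v) (Cg v)) => // x Ux; symmetry.
by apply: (@deriveD _ _ _ f g); apply: diff_derivable; [exact: df|exact: dg].
Qed.

Lemma CkM V k (U : set V) (f g : V -> R) : open U ->
  Ck k U f -> Ck k U g -> Ck k U (fun x => f x * g x).
Proof.
move=> oU; elim: k f g => [|k IHk] f g.
  by move=> cf cg x Ux; apply: cvgM; [exact: cf | exact: cg].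
move=> Cf1 Cg1; have Cf0 := CkW Cf1; have Cg0 := CkW Cg1.
case: Cf1 Cg1 => [df Cf] [dg Cg]; split=> [x Ux|v].
  by apply: (@differentiableM _ _ f g); [exact: df | exact: dg].
have : Ck k U (fun x => f x * 'D_v g x + g x * 'D_v f x).
  by apply: CkD => //; apply: IHk => //; [exact: Cg | exact: Cf].
apply: Ck_ext => // x Ux; symmetry.
by apply: (@deriveM _ _ f g); apply: diff_derivable; [exact: df|exact: dg].
Qed.

Lemma CkZl V W k (U : set V) (f : V -> R) (w : W) : open U ->
  Ck k U f -> Ck k U (fun x => f x *: w).
Proof.
move=> oU; elim: k f => [|k IHk] f.
  by move=> cf x Ux; apply: cvgZ; [exact: cf | exact: cvg_cst].
move=> [df Cf]; split=> [x Ux|v]; first exact/differentiableZl/df.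
apply: Ck_ext (IHk _ (Cf v)) => // x Ux; symmetry.
rewrite deriveE; last exact/differentiableZl/df.
by rewrite diffZl ?deriveE //; exact: df.
Qed.

Lemma Ck_sum V W k (U : set V) (I : Type) (r : seq I) (f : I -> V -> W) :
  open U -> (forall i, Ck k U (f i)) -> Ck k U (fun x => \sum_(i <- r) f i x).
Proof.
move=> oU Cf; elim: r => [|i r IHr].
  by rewrite (_ : (fun _ => _) = cst 0); [exact: Ck_cst | apply/funext => x; rewrite big_nil].
rewrite (_ : (fun _ => _) = (fun x => f i x + \sum_(j <- r) f j x)); first exact: CkD.
by apply/funext => x; rewrite big_cons.
Qed.

Lemma Ck_linear V W W' k (U : set V) (f : V -> W) (l : {linear W -> W'}) :
  open U -> continuous l -> Ck k U f -> Ck k U (fun x => l (f x)).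
Proof.
move=> oU cl; elim: k f => [|k IHk] f.
  by move=> cf x Ux; apply: (@continuous_comp _ _ _ f l); [exact: cf | exact: cl].
have dl y : differentiable l y by exact: linear_differentiable.
move=> [df Cf]; split=> [x Ux|v].
  by apply: (@differentiable_comp _ _ _ _ f l) => //; exact: df.
apply: Ck_ext (IHk _ (Cf v)) => // x Ux; symmetry.
rewrite deriveE; last by apply: (@differentiable_comp _ _ _ _ f l) => //; exact: df.
rewrite (_ : (fun x => l (f x)) = l \o f) // diff_comp ?diff_lin //=; last exact: df.
by rewrite deriveE //; exact: df.
Qed.

Definition rv_coord n (i : 'I_n) (u : 'rV[R]_n) : R := u 0 i.
Fact rv_coord_linear n i : linear (@rv_coord n i).
Proof. by move=> a u v; rewrite /rv_coord !mxE. Qed.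
HB.instance Definition _ n i :=
  GRing.isLinear.Build R 'rV[R]_n R _ (@rv_coord n i) (@rv_coord_linear n i).

Lemma Ck_coord V n k (U : set V) (f : V -> 'rV[R]_n) : open U ->
  Ck k U f <-> forall i, Ck k U (fun x => f x 0 i).
Proof.
move=> oU; split=> [Cf i|Cf].
  apply: (@Ck_linear _ _ _ _ _ f (@rv_coord n i)) => //.
  exact: coord_continuous.
rewrite (_ : f = (fun x => \sum_i f x 0 i *: delta_mx 0 i)).
  by apply: Ck_sum => // i; exact: CkZl.
by apply/funext => x; exact: row_sum_delta.
Qed.

Lemma Ck_comp_scal V n k (U : set V) (A : set 'rV[R]_n)
    (g : V -> 'rV[R]_n) (f : 'rV[R]_n -> R) :
  open U -> (forall x, U x -> A (g x)) ->
  Ck k A f -> Ck k U g -> Ck k U (fun x => f (g x)).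
Proof.
move=> oU UA; elim: k f => [|k IHk] f.
  by move=> cf cg x Ux; apply: (@continuous_comp _ _ _ g f); [exact: cg | exact/cf/UA].
move=> [df Cf] Cg1; have Cg0 := CkW Cg1; case: Cg1 => dg Cg; split=> [x Ux|v].
  by apply: (@differentiable_comp _ _ _ _ g f); [exact: dg | exact/df/UA].
have : Ck k U (fun x => \sum_i ('D_v g x) 0 i * 'D_('e_i) f (g x)).
  apply: Ck_sum => // i; apply: CkM => //; last exact: (IHk ('D_('e_i) f) (Cf _) Cg0).
  exact: ((Ck_coord k ('D_v g) oU).1 (Cg v) i).
apply: Ck_ext => // x Ux; symmetry.
have dgx := dg _ Ux; have dfx := df _ (UA _ Ux).
rewrite deriveE; last exact: (@differentiable_comp _ _ _ _ g f).
rewrite (_ : (fun x => f (g x)) = f \o g) // diff_comp //= -(deriveE v dgx).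
rewrite {1}(row_sum_delta ('D_v g x)) linear_sum; apply: eq_bigr => i _.
by rewrite linearZ /= (deriveE _ dfx).
Qed.

Lemma Ck_comp V n m k (U : set V) (A : set 'rV[R]_n)
    (g : V -> 'rV[R]_n) (f : 'rV[R]_n -> 'rV[R]_m) :
  open U -> open A -> (forall x, U x -> A (g x)) ->
  Ck k A f -> Ck k U g -> Ck k U (fun x => f (g x)).
Proof.
move=> oU oA UA Cf Cg; apply/Ck_coord => // i.
exact: (Ck_comp_scal oU UA ((Ck_coord k f oA).1 Cf i)).
Qed.

End Ck.

Section manifold.
Context {R : realType} {n : nat}.

(* A homeomorphism between the open sets csrc of M and ctgt of R^n; the values
   of cfwd and cbwd outside these sets are irrelevant. *)
Record chart (M : topologicalType) := Chart {
  csrc : set M;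
  ctgt : set 'rV[R]_n;
  cfwd : M -> 'rV[R]_n;
  cbwd : 'rV[R]_n -> M;
  csrc_open : open csrc;
  ctgt_open : open ctgt;
  cfwd_tgt : forall x, csrc x -> ctgt (cfwd x);
  cbwd_src : forall y, ctgt y -> csrc (cbwd y);
  cfwdK : forall x, csrc x -> cbwd (cfwd x) = x;
  cbwdK : forall y, ctgt y -> cfwd (cbwd y) = y;
  cfwd_continuous : {within csrc, continuous cfwd};
  cbwd_continuous : {within ctgt, continuous cbwd} }.

(* The open subset cfwd c @` (U `&` csrc c) of R^n. *)
Definition chart_image (M : topologicalType) (c : chart M) (U : set M) :=
  [set y | ctgt c y /\ U (cbwd c y)].

Lemma chart_image_open (M : topologicalType) (c : chart M) (U : set M) :
  open U -> open (chart_image c U).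
Proof.
rewrite !openE => oU y [cy /oU Uy].
have := @cbwd_continuous _ c.
rewrite continuous_open_subspace; last exact: ctgt_open.
move=> /(_ y); rewrite inE => /(_ cy) cc.
have ny : nbhs y (ctgt c) by apply: open_nbhs_nbhs; split=> //; exact: ctgt_open.
apply: filterS2 ny (cc _ Uy) => z; exact: conj.
Qed.

End manifold.

(* The atlas need not be maximal. *)
Record smoothManifold (R : realType) (n : nat) := SmoothManifold {
  mcarrier :> topologicalType;
  mhausdorff : hausdorff_space mcarrier;
  msecond_countable : @second_countable mcarrier;
  atlas : set (@chart R n mcarrier);
  atlas_cover : forall x, exists2 c, atlas c & csrc c x;
  atlas_compat : forall a b, atlas a -> atlas b ->
    smooth (chart_image a (csrc b)) (cfwd b \o cbwd a) }.

Section smooth_maps.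
Context {R : realType} {n : nat} {M : smoothManifold R n}.
Implicit Types (W : normedModType R) (U : set M).

(* Smoothness of f on the open set U of M. *)
Definition msmooth W U (f : M -> W) :=
  forall c, atlas c -> smooth (chart_image c U) (f \o cbwd c).

Lemma msmooth_local W U (f g : M -> W) :
  (forall x, U x -> exists2 A : set M, open A & A x /\
     msmooth A f /\ forall y, A y -> f y = g y) -> msmooth U g.
Proof.
move=> H c ac k; apply: (@Ck_local _ _ _ _ _ (f \o cbwd c)) => y [cy /H].
move=> [A oA [Ay [sf fg]]]; exists (chart_image c A).
  exact: chart_image_open.
split=> //; split=> [|z [_ Az]]; first exact: sf.
exact: fg.
Qed.

Lemma msmooth_ext W U (f g : M -> W) : open U ->
  (forall x, U x -> f x = g x) -> msmooth U f -> msmooth U g.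
Proof. by move=> oU fg sf; apply: (@msmooth_local _ _ f) => x Ux; exists U. Qed.

Lemma msmooth_sub W U A (f : M -> W) : A `<=` U -> msmooth U f -> msmooth A f.
Proof.
by move=> AU sf c ac k; apply: Ck_sub (sf c ac k) => y [cy /AU].
Qed.

Lemma msmooth_cst W U (w : W) : msmooth U (fun=> w).
Proof. move=> c _ k; exact: Ck_cst. Qed.

Lemma msmoothD W U (f g : M -> W) : open U ->
  msmooth U f -> msmooth U g -> msmooth U (fun x => f x + g x).
Proof.
move=> oU sf sg c ac k; apply: CkD; first exact: chart_image_open.
- exact: sf.
- exact: sg.
Qed.

Lemma msmoothM U (f g : M -> R) : open U ->
  msmooth U f -> msmooth U g -> msmooth U (fun x => f x * g x).
Proof.
move=> oU sf sg c ac k; apply: CkM; first exact: chart_image_open.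
- exact: sf.
- exact: sg.
Qed.

Lemma msmooth_coord m U (f : M -> 'rV[R]_m) : open U ->
  msmooth U f <-> forall i, msmooth U (fun x => f x 0 i).
Proof.
move=> oU; split=> [sf i|sf] c ac k.
  exact: ((Ck_coord k (f \o cbwd c) (chart_image_open (c:=c) oU)).1 (sf c ac k) i).
apply/(Ck_coord k (f \o cbwd c) (chart_image_open (c:=c) oU)) => i; exact: sf.
Qed.

Lemma msmoothZ m U (f : M -> R) (g : M -> 'rV[R]_m) : open U ->
  msmooth U f -> msmooth U g -> msmooth U (fun x => f x *: g x).
Proof.
move=> oU sf sg; apply/msmooth_coord => // i.
rewrite (_ : (fun _ => _) = (fun x => f x * g x 0 i)); last first.
  by apply/funext => x; rewrite mxE.
by apply: msmoothM => //; apply: (msmooth_coord _ oU).1.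
Qed.

Lemma msmooth_sum W U (I : Type) (r : seq I) (f : I -> M -> W) : open U ->
  (forall i, msmooth U (f i)) -> msmooth U (fun x => \sum_(i <- r) f i x).
Proof.
move=> oU sf c ac k; apply: Ck_sum; first exact: chart_image_open.
move=> i; exact: sf.
Qed.

Lemma msmooth_chart m U (c : chart M) (g : 'rV[R]_n -> 'rV[R]_m) :
  atlas c -> open U -> U `<=` csrc c -> smooth (chart_image c U) g ->
  msmooth U (g \o cfwd c).
Proof.
move=> ac oU Uc sg b ab k.
apply: (@Ck_comp _ _ _ _ _ _ (chart_image c U) (cfwd c \o cbwd b)).
- exact: chart_image_open.
- exact: chart_image_open.
- move=> y [ty Uy]; split; first exact/cfwd_tgt/Uc.
  by rewrite /= cfwdK //; exact: Uc.
- exact: sg.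
- apply: Ck_sub (atlas_compat ab ac k) => y [ty /Uc]; exact: conj.
Qed.

Lemma msmooth_chart_scal U (c : chart M) (g : 'rV[R]_n -> R) :
  atlas c -> open U -> U `<=` csrc c -> smooth (chart_image c U) g ->
  msmooth U (g \o cfwd c).
Proof.
move=> ac oU Uc sg b ab k.
apply: (@Ck_comp_scal _ _ _ _ _ (chart_image c U) (cfwd c \o cbwd b)).
- exact: chart_image_open.
- move=> y [ty Uy]; split; first exact/cfwd_tgt/Uc.
  by rewrite /= cfwdK //; exact: Uc.
- exact: sg.
- apply: Ck_sub (atlas_compat ab ac k) => y [ty /Uc]; exact: conj.
Qed.

End smooth_maps.

Section vector_bundles.
Context {R : realType} {n : nat} {M : smoothManifold R n}.

(* A local trivialization V|_tdom ~ tdom x R^r, as fibrewise linear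
   isomorphisms; outside tdom the values of tfwd and tbwd are irrelevant. *)
Record trivialization (V : M -> lmodType R) (r : nat) := Trivialization {
  tdom : set M;
  tfwd : forall x, {linear V x -> 'rV[R]_r};
  tbwd : forall x, 'rV[R]_r -> V x;
  tdom_open : open tdom;
  tfwdK : forall x, tdom x -> cancel (tfwd x) (tbwd x);
  tbwdK : forall x, tdom x -> cancel (tbwd x) (tfwd x) }.

Lemma tbwd_linear (V : M -> lmodType R) r (t : trivialization V r) x :
  tdom t x -> linear (tbwd t x).
Proof.
by move=> tx a u v; apply: (can_inj (tfwdK tx)); rewrite linearP !tbwdK.
Qed.

Lemma tbwd_sum (V : M -> lmodType R) r (t : trivialization V r) x (w : V x) :
  tdom t x -> w = \sum_i (tfwd t x w) 0 i *: tbwd t x (delta_mx 0 i).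
Proof.
move=> tx; apply: (can_inj (tfwdK tx)); rewrite linear_sum /=.
rewrite {1}(row_sum_delta (tfwd t x w)); apply: eq_bigr => i _.
by rewrite linearZ /= tbwdK.
Qed.

End vector_bundles.

(* A vector bundle as a family of fibres with an atlas of local trivializations
   whose changes x |-> t_x \o s_x^-1 (valued in GL_r) are smooth; this data
   determines the topology and smooth structure of the total space. *)
Record vectorBundle (R : realType) (n : nat) (M : smoothManifold R n) :=
  VectorBundle {
  fiber :> M -> lmodType R;
  vbrank : nat;
  vtriv : set (trivialization fiber vbrank);
  vtriv_cover : forall x, exists2 t, vtriv t & tdom t x;
  vtriv_compat : forall s t, vtriv s -> vtriv t -> forall v : 'rV[R]_vbrank,
    msmooth (tdom s `&` tdom t) (fun x => tfwd t x (tbwd s x v)) }.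

Section bundle_maps.
Context {R : realType} {n : nat} {M : smoothManifold R n}.
Implicit Types V W : vectorBundle M.

Definition smooth_section V (s : forall x, V x) :=
  forall t, vtriv t -> msmooth (tdom t) (fun x => tfwd t x (s x)).

Record section V := MkSection {
  section_fun :> forall x, V x;
  section_smooth : smooth_section section_fun }.

Lemma section_eq V (s t : section V) : (forall x, s x = t x) -> s = t.
Proof.
case: s t => [s hs] [t ht] /= st.
have {}st : s = t by apply: functional_extensionality_dep.
by rewrite st in hs *; congr MkSection; exact: Prop_irrelevance.
Qed.

(* Vector bundle morphisms over the identity of M. *)
Record bundleMorphism V W := BundleMorphism {
  bm_fun :> forall x, {linear V x -> W x};
  bm_smooth : forall s t, vtriv s -> vtriv t -> forall v,
    msmooth (tdom s `&` tdom t) (fun x => tfwd t x (bm_fun x (tbwd s x v))) }.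

Lemma bm_section_subproof V W (h : bundleMorphism V W) (s : section V) :
  smooth_section (fun x => h x (s x)).
Proof.
move=> t vt.
pose F x := tfwd t x (h x (s x)).
apply: (@msmooth_local _ _ _ _ _ F) => x tx.
have [a va ax] := vtriv_cover V x.
have oA : open (tdom a `&` tdom t) by apply: openI; exact: tdom_open.
exists (tdom a `&` tdom t) => //; split=> //; split=> //.
pose G x := \sum_i (tfwd a x (s x)) 0 i *: tfwd t x (h x (tbwd a x (delta_mx 0 i))).
apply: (@msmooth_ext _ _ _ _ _ G) => //.
  move=> y [ay ty]; rewrite /F [in RHS](tbwd_sum (s y) ay) !linear_sum /=.
  by apply: eq_bigr => i _; rewrite !linearZ.
apply: msmooth_sum => // i; apply: msmoothZ => //; last exact: bm_smooth.
apply: (msmooth_coord (fun x => tfwd a x (s x)) oA).1.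
by apply: msmooth_sub (section_smooth s va) => y [].
Qed.

(* The induced map Gamma(V) -> Gamma(W). *)
Definition bm_section V W (h : bundleMorphism V W) (s : section V) : section W :=
  MkSection (bm_section_subproof h s).

End bundle_maps.

Section tangent_bundle.
Context {R : realType} {n : nat} (M : smoothManifold R n).

Definition chart_at (x : M) : chart M := s2val (cid2 (atlas_cover x)).

Lemma chart_at_atlas x : atlas (chart_at x).
Proof. exact: s2valP (cid2 (atlas_cover x)). Qed.

Lemma chart_at_src x : csrc (chart_at x) x.
Proof. exact: s2valP' (cid2 (atlas_cover x)). Qed.

(* Differential at cfwd a x of the change of charts from a to b. *)
Definition dtrans (a b : @chart R n M) (x : M) : {linear 'rV[R]_n -> 'rV[R]_n} :=
  'd (cfwd b \o cbwd a) (cfwd a x).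

Lemma near_eq_diff (V W : normedModType R) (f g : V -> W) x :
  (\near x, f x = g x) -> differentiable f x -> 'd f x =1 'd g x.
Proof.
move=> fg df v; rewrite -!deriveE //; first exact: near_eq_derive.
exact: near_eq_differentiable df.
Qed.

Lemma differentiable_trans (a b : @chart R n M) x : atlas a -> atlas b ->
  csrc a x -> csrc b x -> differentiable (cfwd b \o cbwd a) (cfwd a x).
Proof.
move=> aa ab ax bx; have [df _] := atlas_compat aa ab 1.
by apply: df; split; [exact: cfwd_tgt | rewrite /= cfwdK].
Qed.

Lemma near_chart_image (c : @chart R n M) (U : set M) x : open U -> csrc c x ->
  U x -> \forall y \near cfwd c x, chart_image c U y.
Proof.
move=> oU cx Ux; apply: open_nbhs_nbhs; split; first exact: chart_image_open.
by split; [exact: cfwd_tgt | rewrite /= cfwdK].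
Qed.

Lemma diff_chart_change (W : normedModType R) (a b : @chart R n M) (f : M -> W) x :
  atlas a -> atlas b -> csrc a x -> csrc b x ->
  differentiable (f \o cbwd b) (cfwd b x) ->
  forall v, 'd (f \o cbwd b) (cfwd b x) (dtrans a b x v) =
            'd (f \o cbwd a) (cfwd a x) v.
Proof.
move=> aa ab ax bx df v; rewrite /dtrans.
have dt := differentiable_trans aa ab ax bx.
have E : (cfwd b \o cbwd a) (cfwd a x) = cfwd b x by rewrite /= cfwdK.
rewrite -E in df *.
rewrite -[LHS]/(('d (f \o cbwd b) ((cfwd b \o cbwd a) (cfwd a x)) \o
  'd (cfwd b \o cbwd a) (cfwd a x)) v) -diff_comp //.
apply: near_eq_diff; last exact: differentiable_comp.
have := near_chart_image (csrc_open b) ax bx.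
by apply: filterS => y [ya yb] /=; rewrite cfwdK.
Qed.

Lemma dtransK (a b : @chart R n M) x : atlas a -> atlas b ->
  csrc a x -> csrc b x -> cancel (dtrans a b x) (dtrans b a x).
Proof.
move=> aa ab ax bx v; rewrite /dtrans diff_chart_change //; last first.
  exact: differentiable_trans.
rewrite (@near_eq_diff _ _ _ id); first by rewrite diff_val.
  2: exact: differentiable_trans.
have := near_chart_image (csrc_open a) ax ax.
by apply: filterS => y [ya _] /=; rewrite cbwdK.
Qed.

(* The fibre of TM at x is R^n, read in the chart chart_at x: the vector v
   stands for the class of the pairs (c, dtrans (chart_at x) c x v). *)
Definition tan_fiber (x : M) : lmodType R := 'rV[R]_n.

Definition tan_triv (c : @chart R n M) (ac : atlas c) : trivialization tan_fiber n :=
  @Trivialization R n M tan_fiber n (csrc c)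
    (fun x => dtrans (chart_at x) c x) (fun x => dtrans c (chart_at x) x)
    (csrc_open c)
    (fun x cx => dtransK (chart_at_atlas x) ac (chart_at_src x) cx)
    (fun x cx => dtransK ac (chart_at_atlas x) cx (chart_at_src x)).

Definition tan_trivs : set (trivialization tan_fiber n) :=
  [set t | exists c (ac : atlas c), t = tan_triv ac].

Lemma tan_cover x : exists2 t, tan_trivs t & tdom t x.
Proof.
by have [c ac cx] := atlas_cover x; exists (tan_triv ac) => //; exists c, ac.
Qed.

Lemma tan_compat s t : tan_trivs s -> tan_trivs t -> forall v : 'rV[R]_n,
  msmooth (tdom s `&` tdom t) (fun x => tfwd t x (tbwd s x v)).
Proof.
move=> [a [aa ->]] [b [ab ->]] v /=.
have oA : open (csrc a `&` csrc b) by apply: openI; exact: csrc_open.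
apply: (@msmooth_ext _ _ _ _ _ ('D_v (cfwd b \o cbwd a) \o cfwd a)) => //.
  move=> x [ax bx] /=; rewrite deriveE; last exact: differentiable_trans.
  rewrite [RHS]diff_chart_change //; [exact: chart_at_atlas|exact: chart_at_src|].
  by apply: differentiable_trans => //; [exact: chart_at_atlas|exact: chart_at_src].
apply: msmooth_chart => //.
move=> k; have [_ /(_ v)] := atlas_compat aa ab k.+1.
by apply: Ck_sub => y [ya [_ yb]]; split.
Qed.

Definition tangent_bundle : vectorBundle M := VectorBundle tan_cover tan_compat.

End tangent_bundle.

Section smooth_functions.
Context {R : realType} {n : nat} (M : smoothManifold R n).

(* The algebra F(M). *)
Record smoothFun := SmoothFun {
  sfun :> M -> R;
  sfun_smooth : msmooth [set: M] sfun }.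

Lemma smoothFun_eq (f g : smoothFun) : (forall x, f x = g x) -> f = g.
Proof.
case: f g => [f hf] [g hg] /= fg.
have {}fg : f = g by apply/funext.
by rewrite fg in hf *; congr SmoothFun; exact: Prop_irrelevance.
Qed.

HB.instance Definition _ := gen_eqMixin smoothFun.
HB.instance Definition _ := gen_choiceMixin smoothFun.

Definition sfun_cst (a : R) := SmoothFun (@msmooth_cst _ _ M _ setT a).
Definition sfun_add (f g : smoothFun) :=
  SmoothFun (msmoothD openT (sfun_smooth f) (sfun_smooth g)).
Definition sfun_mul (f g : smoothFun) :=
  SmoothFun (msmoothM openT (sfun_smooth f) (sfun_smooth g)).
Definition sfun_opp (f : smoothFun) := sfun_mul (sfun_cst (-1)) f.
Definition sfun_scale (a : R) (f : smoothFun) := sfun_mul (sfun_cst a) f.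

Fact sfun_addA : associative sfun_add.
Proof. by move=> f g h; apply: smoothFun_eq => x /=; rewrite addrA. Qed.
Fact sfun_addC : commutative sfun_add.
Proof. by move=> f g; apply: smoothFun_eq => x /=; rewrite addrC. Qed.
Fact sfun_add0 : left_id (sfun_cst 0) sfun_add.
Proof. by move=> f; apply: smoothFun_eq => x /=; rewrite add0r. Qed.
Fact sfun_addN : left_inverse (sfun_cst 0) sfun_opp sfun_add.
Proof. by move=> f; apply: smoothFun_eq => x /=; rewrite mulN1r addNr. Qed.
HB.instance Definition _ := GRing.isZmodule.Build smoothFun
  sfun_addA sfun_addC sfun_add0 sfun_addN.

Fact sfun_mulA : associative sfun_mul.
Proof. by move=> f g h; apply: smoothFun_eq => x /=; rewrite mulrA. Qed.
Fact sfun_mulC : commutative sfun_mul.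
Proof. by move=> f g; apply: smoothFun_eq => x /=; rewrite mulrC. Qed.
Fact sfun_mul1 : left_id (sfun_cst 1) sfun_mul.
Proof. by move=> f; apply: smoothFun_eq => x /=; rewrite mul1r. Qed.
Fact sfun_mulDl : left_distributive sfun_mul +%R.
Proof. by move=> f g h; apply: smoothFun_eq => x /=; rewrite mulrDl. Qed.
HB.instance Definition _ := GRing.Zmodule_isComPzRing.Build smoothFun
  sfun_mulA sfun_mulC sfun_mul1 sfun_mulDl.

Fact sfun_scaleA a b f : sfun_scale a (sfun_scale b f) = sfun_scale (a * b) f.
Proof. by apply: smoothFun_eq => x /=; rewrite mulrA. Qed.
Fact sfun_scale1 : left_id 1 sfun_scale.
Proof. by move=> f; apply: smoothFun_eq => x /=; rewrite mul1r. Qed.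
Fact sfun_scaleDr : right_distributive sfun_scale +%R.
Proof. by move=> a f g; apply: smoothFun_eq => x /=; rewrite mulrDr. Qed.
Fact sfun_scaleDl f : {morph sfun_scale^~ f : a b / a + b}.
Proof. by move=> a b; apply: smoothFun_eq => x /=; rewrite mulrDl. Qed.
HB.instance Definition _ := GRing.Zmodule_isLmodule.Build R smoothFun
  sfun_scaleA sfun_scale1 sfun_scaleDr sfun_scaleDl.

End smooth_functions.

Section section_module.
Context {R : realType} {n : nat} {M : smoothManifold R n} (V : vectorBundle M).
Implicit Types s t : section V.

HB.instance Definition _ := gen_eqMixin (section V).
HB.instance Definition _ := gen_choiceMixin (section V).

Fact section0_smooth : smooth_section (fun x => 0 : V x).
Proof.
move=> t _; apply: (@msmooth_ext _ _ _ _ _ (fun=> 0)); first exact: tdom_open.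
  by move=> x _; rewrite linear0.
exact: msmooth_cst.
Qed.

Fact section_add_smooth s s' : smooth_section (fun x => s x + s' x).
Proof.
move=> t vt; apply: (@msmooth_ext _ _ _ _ _
  (fun x => tfwd t x (s x) + tfwd t x (s' x))); first exact: tdom_open.
  by move=> x _; rewrite linearD.
by apply: msmoothD; [exact: tdom_open | exact: section_smooth..].
Qed.

Fact section_fscale_smooth (f : smoothFun M) s : smooth_section (fun x => f x *: s x).
Proof.
move=> t vt; apply: (@msmooth_ext _ _ _ _ _
  (fun x => f x *: tfwd t x (s x))); first exact: tdom_open.
  by move=> x _; rewrite linearZ.
apply: msmoothZ; [exact: tdom_open | | exact: section_smooth].
exact: msmooth_sub (sfun_smooth f).
Qed.

Definition section0 := MkSection section0_smooth.
Definition section_add s s' := MkSection (section_add_smooth s s').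
(* The F(M)-module structure of Gamma(V); *: is the action of R. *)
Definition fscale (f : smoothFun M) s := MkSection (section_fscale_smooth f s).
Definition section_opp s := fscale (sfun_cst M (-1)) s.
Definition section_scale (a : R) s := fscale (sfun_cst M a) s.

Fact section_addA : associative section_add.
Proof. by move=> f g h; apply: section_eq => x /=; rewrite addrA. Qed.
Fact section_addC : commutative section_add.
Proof. by move=> f g; apply: section_eq => x /=; rewrite addrC. Qed.
Fact section_add0 : left_id section0 section_add.
Proof. by move=> f; apply: section_eq => x /=; rewrite add0r. Qed.
Fact section_addN : left_inverse section0 section_opp section_add.
Proof. by move=> f; apply: section_eq => x /=; rewrite scaleN1r addNr. Qed.
HB.instance Definition _ := GRing.isZmodule.Build (section V)
  section_addA section_addC section_add0 section_addN.

Fact section_scaleA a b s :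
  section_scale a (section_scale b s) = section_scale (a * b) s.
Proof. by apply: section_eq => x /=; rewrite scalerA. Qed.
Fact section_scale1 : left_id 1 section_scale.
Proof. by move=> f; apply: section_eq => x /=; rewrite scale1r. Qed.
Fact section_scaleDr : right_distributive section_scale +%R.
Proof. by move=> a f g; apply: section_eq => x /=; rewrite scalerDr. Qed.
Fact section_scaleDl s : {morph section_scale^~ s : a b / a + b}.
Proof. by move=> a b; apply: section_eq => x /=; rewrite scalerDl. Qed.
HB.instance Definition _ := GRing.Zmodule_isLmodule.Build R (section V)
  section_scaleA section_scale1 section_scaleDr section_scaleDl.

End section_module.

Section vector_fields.
Context {R : realType} {n : nat} {M : smoothManifold R n}.
Implicit Types (X Y Z : section (tangent_bundle M)) (f : smoothFun M).

Fact vact_smooth X f : msmooth [set: M]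
  (fun x => 'd (f \o cbwd (chart_at x)) (cfwd (chart_at x) x) (X x)).
Proof.
set F := fun x => _.
apply: (@msmooth_local _ _ _ _ _ F) => x _.
have [c ac cx] := atlas_cover x.
have oc := csrc_open c.
exists (csrc c) => //; split=> //; split=> //.
have df b y : atlas b -> csrc b y -> differentiable (f \o cbwd b) (cfwd b y).
  move=> ab yb; have [+ _] := sfun_smooth f ab 1; apply.
  by split=> //; exact: cfwd_tgt.
have vc : vtriv (tan_triv ac : trivialization (tangent_bundle M) _).
  by exists c, ac.
pose Xc y := dtrans (chart_at y) c y (X y).
have sXc : msmooth (csrc c) Xc by exact: (section_smooth X vc).
apply: (@msmooth_ext _ _ _ _ _ (fun y => \sum_i Xc y 0 i *
   ('D_('e_i) (f \o cbwd c) \o cfwd c) y)) => //.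
  move=> y cy; rewrite /F.
  rewrite -(diff_chart_change (chart_at_atlas y) ac (chart_at_src y) cy); last exact: df.
  rewrite -/(Xc y) [in RHS](row_sum_delta (Xc y)) linear_sum; apply: eq_bigr => i _.
  by rewrite linearZ /= (deriveE _ (df _ _ ac cy)).
apply: msmooth_sum => // i; apply: msmoothM => //.
  exact: (msmooth_coord Xc oc).1.
apply: msmooth_chart_scal => // k.
have [_ /(_ 'e_i)] := sfun_smooth f ac k.+1.
by apply: Ck_sub => y [].
Qed.

(* The derivative X f of f along the vector field X. *)
Definition vact X f : smoothFun M := SmoothFun (vact_smooth X f).

(* [X, Y] = Z, vector fields being identified with derivations of F(M). *)
Definition is_lie_bracket X Y Z :=
  forall f, vact Z f = vact X (vact Y f) - vact Y (vact X f).

End vector_fields.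

Record bundleMetric (R : realType) (n : nat) (M : smoothManifold R n)
    (V : vectorBundle M) := BundleMetric {
  met :> forall x, {biscalar (V x)};
  met_sym : forall x (u v : V x), met x u v = met x v u;
  met_nondeg : forall x (u : V x), (forall v, met x u v = 0) -> u = 0;
  met_smooth : forall t, vtriv t -> forall u v : 'rV[R]_(vbrank V),
    msmooth (tdom t) (fun x => met x (tbwd t x u) (tbwd t x v)) }.

Section pairing.
Context {R : realType} {n : nat} {M : smoothManifold R n} {V : vectorBundle M}.

Fact pair_smooth (g : bundleMetric V) (s s' : section V) :
  msmooth [set: M] (fun x => g x (s x) (s' x)).
Proof.
set F := fun x => _.
apply: (@msmooth_local _ _ _ _ _ F) => x _.
have [t vt tx] := vtriv_cover V x.
have ot := tdom_open t.
exists (tdom t) => //; split=> //; split=> //.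
pose e i y := tbwd t y ('e_i : 'rV[R]_(vbrank V)).
have sc (w : section V) i : msmooth (tdom t) (fun y => (tfwd t y (w y)) 0 i).
  exact: ((msmooth_coord (fun y => tfwd t y (w y)) ot).1 (section_smooth w vt)).
apply: (@msmooth_ext _ _ _ _ _ (fun y => \sum_i (tfwd t y (s y)) 0 i *
   \sum_j (tfwd t y (s' y)) 0 j * g y (e i y) (e j y))) => //.
  move=> y ty; rewrite /F [in RHS](tbwd_sum (s y) ty) linear_sumlz /=.
  apply: eq_bigr => i _; rewrite linearZl_LR /=; congr (_ * _).
  rewrite [in RHS](tbwd_sum (s' y) ty) linear_sumr /=.
  by apply: eq_bigr => j _; rewrite linearZr.
apply: msmooth_sum => // i; apply: msmoothM => //.
apply: msmooth_sum => // j; apply: msmoothM => //.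
exact: met_smooth.
Qed.

Definition pair (g : bundleMetric V) (s s' : section V) : smoothFun M :=
  SmoothFun (pair_smooth g s s').

End pairing.

Record anchoredAlmostAlgebroid (R : realType) (n : nat) (M : smoothManifold R n) :=
  AnchoredAlmostAlgebroid {
  abundle :> vectorBundle M;
  anchor : bundleMorphism abundle (tangent_bundle M);
  amul : {bilinear section abundle -> section abundle -> section abundle} }.

Section courant_operations.
Context {R : realType} {n : nat} {M : smoothManifold R n}.
Variable A : anchoredAlmostAlgebroid M.
Implicit Types s : section A.

Definition rho s : section (tangent_bundle M) := bm_section (anchor A) s.

Definition associator s1 s2 s3 : section A :=
  amul A s1 (amul A s2 s3) - amul A (amul A s1 s2) s3.

Definition delta_met (g : bundleMetric A) s1 s2 s3 : smoothFun M :=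
  - vact (rho s1) (pair g s2 s3)
  + pair g (amul A s1 s2) s3 + pair g s2 (amul A s1 s3)
  + vact (rho s2) (pair g s1 s3)
  - pair g (amul A s2 s1) s3 - pair g s1 (amul A s2 s3).

End courant_operations.

Definition one_cocycle (R : realType) (n : nat) (M : smoothManifold R n)
    (V : vectorBundle M) (D : {linear smoothFun M -> section V}) :=
  forall f g : smoothFun M, D (f * g) = fscale f (D g) + fscale g (D f).

Record nonAsymmetricCourant (R : realType) (n : nat) (M : smoothManifold R n) :=
  NonAsymmetricCourant {
  calg :> anchoredAlmostAlgebroid M;
  cmet : bundleMetric calg;
  cD : {linear smoothFun M -> section calg};
  cD_cocycle : one_cocycle cD;
  courant_R1 : forall s1 s2 s3 : section calg,
    associator s1 s2 s3 - associator s2 s1 s3 = cD (delta_met cmet s1 s2 s3);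
  courant_R2 : forall (f : smoothFun M) (s1 s2 : section calg),
    amul calg (fscale f s1) s2 = fscale f (amul calg s1 s2);
  courant_R3 : forall s1 s2 s3 : section calg,
    vact (rho s1) (pair cmet s2 s3) =
      pair cmet (amul calg s1 s2 + cD (pair cmet s1 s2)) s3
      + pair cmet s2 (amul calg s1 s3 + cD (pair cmet s1 s3)) }.

(* Main.v *)
Require Import Defs.
From mathcomp Require Import all_boot all_order all_algebra.
From mathcomp Require Import all_classical all_reals.
From mathcomp Require Import topology normedtype landau derive.
From mathcomp Require Import sequences realfun exp ring lra.
Import Order.TTheory GRing.Theory Num.Theory.
Import numFieldNormedType.Exports.
Local Open Scope classical_set_scope.
Local Open Scope ring_scope.
Set Implicit Arguments.
Unset Strict Implicit.
Unset Printing Implicit Defensive.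

(** The multiplication fails to be function-linear in its second argument in a
    way that (R3) makes explicit ([courant_leibniz]):
      s(ft) = f(st) + rho(s)(f) t - <s,t> Df.
    Put [f u] in the third slot of (R1), expand everything with this rule, and
    subtract [f] times (R1) at [u].  The second order terms assemble into
      K = [rho(s), rho(t)]f - rho(st)f + rho(ts)f,
    the function that has to vanish, and the remainder is [anchor_defect_pair]:
      K u = <s,u> E(t,f) - <t,u> E(s,f),
    where E(s,f) = D(rho(s)f) - s(Df) - D<s,Df>.  The section [u] is arbitrary,
    so at a given point it may be chosen nonzero and orthogonal to both [s] and
    [t]: this is where rank at least three enters, two linear conditions on a
    space of dimension at least three having a nonzero common solution
    ([exists_orthogonal]).  The right-hand side then vanishes at that point,
    hence so does K.

    Both the cancellation of a section from pairings with all other sections and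
    the choice of [u] at a point require global sections with prescribed value
    at a point ([section_through]).  These come from bump functions, built from
    the classical flat function exp(-1/t); the Hausdorff property of the
    manifold is what makes the extension by zero of a bump function smooth. *)

(** * The flat function exp(-1/t) *)

Section flat_function.
Context {R : realType}.
Implicit Types (m k : nat) (t : R).

(** The factor t^-m makes the family closed under differentiation, up to linear
    combinations with constant coefficients; the function exp(-1/t) itself is
    [flat 0]. *)
Definition flat m t : R := if 0 < t then t^-1 ^+ m * expR (- t^-1) else 0.

Lemma flat_le0 m t : t <= 0 -> flat m t = 0.
Proof. by rewrite /flat leNgt; case: (0 < t). Qed.

Lemma flat_gt0 m t : 0 < t -> 0 < flat m t.
Proof.
by move=> t0; rewrite /flat t0 mulr_gt0 ?expR_gt0 // exprn_gt0 // invr_gt0.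
Qed.

(** A quadratic bound forces the derivative at 0 to be 0.  It follows from
    u^(m+2)/(m+2)! <= exp u at u = 1/t. *)
Lemma flat_quadratic m t : `|flat m t| <= m.+2`!%:R * t ^+ 2.
Proof.
have [t0|t0] := leP t 0.
  by rewrite flat_le0 // normr0 mulr_ge0 // sqr_ge0.
rewrite gtr0_norm ?flat_gt0 // /flat t0 expRN.
have u0 : 0 < t^-1 by rewrite invr_gt0.
have E : t^-1 ^+ m.+2 / m.+2`!%:R <= expR t^-1.
  by apply: le_trans (expR_ge1Dxn m.+1 (ltW u0)); rewrite lerDr.
rewrite ler_pdivrMr ?expR_gt0 //.
have F0 : 0 < m.+2`!%:R :> R by rewrite ltr0n fact_gt0.
have -> : t^-1 ^+ m = m.+2`!%:R * t ^+ 2 * (t^-1 ^+ m.+2 / m.+2`!%:R).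
  rewrite -addn2 exprD !exprVn; field.
  by rewrite addn2 (gt_eqF F0) (gt_eqF t0) expf_neq0 // gt_eqF.
by rewrite ler_wpM2l // mulr_ge0 ?sqr_ge0 // ltW.
Qed.

Lemma flat_derive m t :
  is_derive t 1 (flat m) (flat m.+2 t - m%:R * flat m.+1 t).
Proof.
have [t0|t0|->] := ltgtP t 0.
- rewrite !flat_le0 ?(ltW t0) // mulr0 subr0.
  apply: (@near_eq_is_derive _ _ _ (cst 0)).
  by near=> s; rewrite flat_le0 //; apply/ltW; near: s; exact: lt_nbhsl.
- apply: (@near_eq_is_derive _ _ _
      ((fun s : R => s^-1) ^+ m * (expR \o (- (fun s : R => s^-1))))).
    near=> s; have s0 : 0 < s by near: s; exact: lt_nbhsr.
    by rewrite /flat s0 /= !fctE.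
  have t1 : id t != 0 by rewrite gt_eqF.
  have iV := is_deriveV t1 (is_derive_id t 1).
  have iX : is_derive t 1 ((fun s : R => s^-1) ^+ m)
    ((m%:R * t^-1 ^+ m.-1) *: (- t ^- 2 *: 1)) by exact: is_deriveX iV.
  have iE : is_derive t 1 (expR \o (- (fun s : R => s^-1)))
      (expR (- t^-1) * - (- t ^- 2 *: 1)).
    exact: is_derive1_comp (is_derive_expR _) (is_deriveN iV).
  have iM := is_deriveM iX iE.
  apply: is_derive_eq iM _.
  rewrite /flat t0 /= !fctE /GRing.scale /= -[t ^- 2]exprVn.
  by case: (m) => [|j] /=; rewrite ?exprS; ring.
- rewrite !(flat_le0 _ (lexx 0)) mulr0 subr0.
  have cv : h^-1 *: (flat m (h *: 1 + 0) - flat m 0) @[h --> 0^'] --> (0 : R).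
    apply/cvgr0Pnorm_lt => e e0.
    have F0 : 0 < m.+2`!%:R :> R by rewrite ltr0n fact_gt0.
    near=> h.
    have h0 : h != 0 by near: h; exact: nbhs_dnbhs_neq.
    have hlt : `|h| < e / m.+2`!%:R.
      by near: h; apply: dnbhs0_lt; rewrite divr_gt0.
    rewrite (flat_le0 _ (lexx 0)) subr0 addr0 [h%:A]mulr1 normrZ normfV.
    rewrite ltr_pdivlMr // in hlt.
    apply: le_lt_trans hlt; rewrite ler_pdivrMl ?normr_gt0 //.
    apply: le_trans (flat_quadratic _ _) _.
    by rewrite mulrA -expr2 real_normK ?num_real // mulrC.
  have dv : derivable (flat m) 0 1 by apply/cvg_ex; exists 0.
  by apply: DeriveDef => //; apply: cvg_lim => //; exact: norm_hausdorff.
Unshelve. all: by end_near.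
Qed.

(** Composing with [q] in the statement, for all [m] at once, lets the induction
    on [k] go through: the chain rule stays within the family. *)
Lemma flat_comp_Ck (V : normedModType R) k (U : set V) (q : V -> R) m :
  open U -> Ck k U q -> Ck k U (flat m \o q).
Proof.
move=> oU; elim: k m => [|k IHk] m.
  move=> cq x Ux; apply: continuous_comp; first exact: cq.
  have [d _] := flat_derive m (q x).
  exact/differentiable_continuous/derivable1_diffP.
move=> Cq; have Cq0 := CkW Cq; case: Cq => dq Cq.
have df t : differentiable (flat m) t.
  by have [d _] := flat_derive m t; exact/derivable1_diffP.
split=> [x Ux|v]; first by apply: differentiable_comp => //; exact: dq.
have : Ck k U (fun x =>
    ((flat m.+2 \o q) x + (- m%:R) * (flat m.+1 \o q) x) * 'D_v q x).
  apply: CkM => //; last exact: Cq.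
  apply: CkD => //; first exact: IHk.
  by apply: CkM => //; [exact: Ck_cst | exact: IHk].
apply: Ck_ext => // x Ux; symmetry.
rewrite deriveE; last by apply: differentiable_comp => //; exact: dq.
rewrite diff_comp //=; last exact: dq.
rewrite -(deriveE v (dq _ Ux)) -[X in 'd _ _ X]mulr1 linearZ /= -deriveE //.
have [_ ->] := flat_derive m (q x).
by rewrite mulNr [LHS]mulrC.
Qed.

End flat_function.

(** * Bump functions and sections with a prescribed value *)

Section bump.
Context {R : realType} {n : nat}.

Lemma Ck_id (V : normedModType R) k (U : set V) : Ck k U (id : V -> V).
Proof.
case: k => [|k] /=; first by move=> x _; exact: cvg_id.
split=> // v.
rewrite (_ : 'D_v id = cst v) //; first exact: Ck_cst.
by apply/funext => x; rewrite derive_id.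
Qed.

(** A polynomial positive exactly on the Euclidean ball of radius [r > 0] around [p]:
    its composite with [flat 0] is a bump function on R^n. *)
Definition bump_poly (p : 'rV[R]_n) (r : R) (y : 'rV[R]_n) : R :=
  r ^+ 2 - \sum_i (y 0 i - p 0 i) ^+ 2.

Lemma bump_poly_Ck p r k : Ck k setT (bump_poly p r).
Proof.
have oT : open [set: 'rV[R]_n] by exact: openT.
rewrite (_ : bump_poly p r = fun y => r ^+ 2 +
    - 1 * \sum_i (y 0 i + - p 0 i) * (y 0 i + - p 0 i)); last first.
  by apply/funext => y; rewrite /bump_poly mulN1r.
apply: CkD => //; first exact: Ck_cst.
apply: CkM => //; first exact: Ck_cst.
apply: Ck_sum => // i.
have C : Ck k setT (fun y : 'rV[R]_n => y 0 i + - p 0 i).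
  apply: CkD => //; last exact: Ck_cst.
  exact: (Ck_coord k id oT).1 (Ck_id _ _) i.
exact: CkM.
Qed.

Lemma bump_poly_cube p r y : 0 < r -> 0 < bump_poly p r y ->
  forall i, y 0 i \in `[p 0 i - r, p 0 i + r].
Proof.
move=> r0; rewrite subr_gt0 => ltr i /=; rewrite in_itv /= -ler_distlC.
rewrite -ler_sqr ?nnegrE ?(ltW r0) // real_normK ?num_real //.
apply: ltW; apply: le_lt_trans ltr.
rewrite -sqrrN opprB (bigD1 i) //= lerDl.
by apply: sumr_ge0 => j _; exact: sqr_ge0.
Qed.

Lemma cube_sub_nbhs (p : 'rV[R]_n) (A : set 'rV[R]_n) : nbhs p A ->
  exists2 r : R, 0 < r & [set y : 'rV[R]_n | forall i, y 0 i \in `[p 0 i - r, p 0 i + r]] `<=` A.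
Proof.
move=> /nbhs_ballP [e /= e0 eA]; exists (e / 2); first by rewrite divr_gt0.
move=> y yp; apply: eA; split=> // i j; rewrite [i]ord1.
have := yp j; rewrite /= in_itv /= -ler_distlC => H.
rewrite /ball /= distrC; apply: le_lt_trans (_ : e / 2 < e); last lra.
by rewrite distrC.
Qed.

Variable M : smoothManifold R n.

(** The bump in a chart is supported in a compact cube; the image [K] of the cube
    is compact, hence closed in the Hausdorff space [M], so that [~` K] and the
    chart domain form an open cover on which smoothness can be checked. *)
Lemma bump_function (x : M) (A : set M) : open A -> A x ->
  exists (f : smoothFun M) (K : set M),
    [/\ 0 < f x, closed K, K `<=` A & forall y, ~ K y -> f y = 0].
Proof.
move=> oA Ax; have [c ac cx] := atlas_cover x.
pose p := cfwd c x.
have [r r0 rA] := cube_sub_nbhs (near_chart_image oA cx Ax).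
pose B := [set y : 'rV[R]_n | forall i, y 0 i \in `[p 0 i - r, p 0 i + r]].
have BA : B `<=` chart_image c A by exact: rA.
have cB : compact B.
  by apply: (@rV_compact R n (fun i => [set` `[p 0 i - r, p 0 i + r]])) => i; exact: segment_compact.
pose K := cbwd c @` B.
have cK : closed K.
  apply: compact_closed; first exact: mhausdorff.
  apply: continuous_compact => //.
  by apply: (continuous_subspaceW _ (@cbwd_continuous _ _ _ c)) => y /BA [].
have KA : K `<=` A by move=> _ [y /BA [_ ?] <-].
have Kc : K `<=` csrc c by move=> _ [y /BA [cy _] <-]; exact: cbwd_src.
pose b y := flat 0 (bump_poly p r y).
pose F y := if `[< csrc c y >] then b (cfwd c y) else 0.
have F0 y : ~ K y -> F y = 0.
  move=> nK; rewrite /F; case: asboolP => // cy; apply: flat_le0.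
  rewrite leNgt; apply/negP => /(bump_poly_cube r0) Bp; apply: nK.
  by exists (cfwd c y) => //; rewrite cfwdK.
have sb : msmooth (csrc c) (b \o cfwd c).
  apply: msmooth_chart_scal => //; first exact: csrc_open.
  move=> k; apply: flat_comp_Ck; last exact: Ck_sub (bump_poly_Ck p r k).
  exact/chart_image_open/csrc_open.
have sF : msmooth [set: M] F.
  apply: (@msmooth_local _ _ _ _ _ F) => y _.
  have [Ky|nKy] := pselect (K y).
    exists (csrc c); first exact: csrc_open.
    split; first exact: Kc.
    split=> //; apply: msmooth_ext sb; first exact: csrc_open.
    by move=> z cz; rewrite /F asboolT.
  exists (~` K); first exact: closed_openC.
  split=> //; split=> //; apply: (@msmooth_ext _ _ _ _ _ (fun=> 0)).
  - exact: closed_openC.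
  - by move=> z /F0.
  - exact: msmooth_cst.
exists (SmoothFun sF), K; split=> //=.
rewrite /F asboolT //; apply: flat_gt0.
by rewrite /bump_poly big1 ?subr0 ?exprn_gt0 // => i _; rewrite subrr expr0n.
Qed.

(** A constant vector in a local trivialization, multiplied by a bump function
    supported in its domain and normalized at [x]. *)
Lemma section_through (V : vectorBundle M) (x : M) (w : V x) :
  exists s : section V, s x = w.
Proof.
have [t vt tx] := vtriv_cover V x.
have [f [K [fx cK Kt f0]]] := bump_function (tdom_open t) tx.
pose v := (f x)^-1 *: tfwd t x w.
pose S y : V y := if `[< tdom t y >] then f y *: tbwd t y v else 0.
have S0 y : ~ K y -> S y = 0.
  by move=> /f0 fy; rewrite /S fy scale0r if_same.
have sS : smooth_section S.
  move=> t' vt'; apply: (@msmooth_local _ _ _ _ _ (fun y => tfwd t' y (S y))) => y t'y.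
  have [Ky|nKy] := pselect (K y).
    have oA : open (tdom t `&` tdom t') by apply: openI; exact: tdom_open.
    exists (tdom t `&` tdom t') => //; split; first by split=> //; exact: Kt.
    split=> //; apply: (@msmooth_ext _ _ _ _ _
      (fun z => f z *: tfwd t' z (tbwd t z v))) => //.
      by move=> z [tz _]; rewrite /S asboolT // linearZ.
    apply: msmoothZ => //; last exact: vtriv_compat.
    exact: msmooth_sub (sfun_smooth f).
  have oK : open (~` K) by exact: closed_openC.
  exists (~` K) => //; split=> //; split=> //.
  apply: (@msmooth_ext _ _ _ _ _ (fun=> 0)) => //; last exact: msmooth_cst.
  by move=> z /S0 ->; rewrite linear0.
exists (MkSection sS) => /=; rewrite /S asboolT //.
apply: (can_inj (tfwdK tx)).
by rewrite linearZ /= tbwdK // scalerA divff ?scale1r // gt_eqF.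
Qed.

End bump.

(** * Vector fields and metrics *)

Section derivations.
Context {R : realType} {n : nat} {M : smoothManifold R n}.
Implicit Types (X Y : section (tangent_bundle M)) (f g : smoothFun M).

Lemma vactM X f g : vact X (f * g) = f * vact X g + g * vact X f.
Proof.
apply: smoothFun_eq => x /=.
have cx := chart_at_src x; have ac := chart_at_atlas x.
have df (h : smoothFun M) :
    differentiable (h \o cbwd (chart_at x)) (cfwd (chart_at x) x).
  have [+ _] := sfun_smooth h ac 1; apply.
  by split=> //; exact: cfwd_tgt.
rewrite (_ : _ \o cbwd _ =
  (f \o cbwd (chart_at x)) * (g \o cbwd (chart_at x))) //.
by rewrite diffM //= cfwdK.
Qed.

Lemma vactB X Y f : vact (X - Y) f = vact X f - vact Y f.
Proof.
apply: smoothFun_eq => x /=.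
by rewrite scaleN1r linearB mulN1r.
Qed.

End derivations.

Section orthogonal.
Context {R : realType} {n : nat} {M : smoothManifold R n} {V : vectorBundle M}.

(** The two orthogonality conditions form a matrix with two columns, whose row
    kernel is nonzero as soon as it has at least three rows. *)
Lemma exists_orthogonal (g : bundleMetric V) (x : M) (a b : V x) :
  (2 < vbrank V)%N -> exists2 u : V x, u != 0 & g x a u = 0 /\ g x b u = 0.
Proof.
move=> r2; have [t vt tx] := vtriv_cover V x.
pose A : 'M[R]_(vbrank V, 2) := \matrix_(i, j)
  g x (if j == 0 then a else b) (tbwd t x (delta_mx 0 i)).
have : kermx A != 0.
  rewrite -mxrank_eq0 mxrank_ker subn_eq0 -ltnNge.
  exact: leq_ltn_trans (rank_leq_col A) r2.
move=> /rowV0Pn [u /sub_kermxP uA u0].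
have E : tfwd t x (tbwd t x u) = u by exact: tbwdK.
have P j : g x (if j == 0 :> 'I_2 then a else b) (tbwd t x u) = 0.
  have := congr1 (fun B : 'rV_2 => B 0 j) uA; rewrite !mxE => <-.
  rewrite {1}(tbwd_sum (tbwd t x u) tx) linear_sumr /= E; apply: eq_bigr => i _.
  by rewrite linearZr mxE.
exists (tbwd t x u); last by split; [exact: P 0 | exact: P 1].
by apply: contra u0 => /eqP u0; rewrite -E u0 linear0.
Qed.

End orthogonal.

Section pairing.
Context {R : realType} {n : nat} {M : smoothManifold R n} {V : vectorBundle M}.
Variable g : bundleMetric V.
Implicit Types (a b c : section V) (f h : smoothFun M).

Lemma pairC a b : pair g a b = pair g b a.
Proof. by apply: smoothFun_eq => x /=; exact: met_sym. Qed.

Lemma pairDl a b c : pair g (a + b) c = pair g a c + pair g b c.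
Proof. by apply: smoothFun_eq => x /=; exact: linearDl. Qed.

Lemma pairBl a b c : pair g (a - b) c = pair g a c - pair g b c.
Proof. by apply: smoothFun_eq => x /=; rewrite scaleN1r linearBl mulN1r. Qed.

Lemma pairZl f a b : pair g (fscale f a) b = f * pair g a b.
Proof. by apply: smoothFun_eq => x /=; rewrite linearZl_LR. Qed.

Lemma pairDr a b c : pair g a (b + c) = pair g a b + pair g a c.
Proof. by rewrite pairC pairDl !(pairC _ a). Qed.

Lemma pairBr a b c : pair g a (b - c) = pair g a b - pair g a c.
Proof. by rewrite pairC pairBl !(pairC _ a). Qed.

Lemma pairZr f a b : pair g a (fscale f b) = f * pair g a b.
Proof. by rewrite pairC pairZl pairC. Qed.

(** Nondegeneracy is a pointwise condition; it passes to sections since every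
    vector is the value of a section. *)
Lemma pair_inj a b : (forall w, pair g a w = pair g b w) -> a = b.
Proof.
move=> ab; apply: section_eq => x; apply/subr0_eq; apply: (@met_nondeg _ _ _ _ g) => v.
have [w wx] := section_through v.
have /(congr1 (fun h : smoothFun M => h x)) /= := ab w.
by rewrite wx linearBl => ->; rewrite subrr.
Qed.

End pairing.

(** * Non asymmetric Courant algebroids *)

Section courant.
Context {R : realType} {n : nat} {M : smoothManifold R n}.
Variable C : nonAsymmetricCourant M.
Implicit Types (s t u w : section C) (f h : smoothFun M).

Local Notation "<| a , b |>" := (pair (cmet C) a b) (at level 0, format "<| a ,  b |>").
Local Notation "a ** b" := (amul C a b) (at level 40).
Local Notation D := (cD C).
Local Notation "s #> f" := (vact (rho s) f) (at level 40).

(** Compare (R3) at [s, f t, w] with [f] times (R3) at [s, t, w]: the derivation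
    rules for [rho s] and [D] account for all the terms but the product. *)
Lemma courant_leibniz s t f :
  s ** fscale f t = fscale f (s ** t) + fscale (s #> f) t - fscale <| s, t |> (D f).
Proof.
apply: (@pair_inj _ _ _ _ (cmet C)) => w.
have := courant_R3 s (fscale f t) w.
rewrite !(pairZr, pairZl) vactM (courant_R3 s t w) cD_cocycle.
rewrite !(pairBl, pairDl, pairDr, pairZr, pairZl) => E.
apply/subr0_eq; move/eqP: E; rewrite -subr_eq0 => /eqP E.
by rewrite -oppr0 -E; ring.
Qed.

Definition anchor_defect s t f : smoothFun M :=
  s #> (t #> f) - t #> (s #> f) - ((s ** t) #> f - (t ** s) #> f).

(** It measures how far [D] is from intertwining [rho s] with the left
    multiplication by [s], up to the exact term [D <s, D f>]. *)
Definition cD_defect s f : section C :=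
  D (s #> f) - s ** D f - D <| s, D f |>.

(** The derivatives of [f] along [rho s] and [rho t] cancel, leaving only the
    contribution of the last term of [courant_leibniz]. *)
Lemma delta_met_fscale s t f u :
  delta_met (cmet C) s t (fscale f u) =
  f * delta_met (cmet C) s t u - <| s, u |> * <| t, D f |> + <| t, u |> * <| s, D f |>.
Proof.
rewrite /delta_met !courant_leibniz.
rewrite !(pairZr, pairZl, pairBr, pairDr) !vactM.
ring.
Qed.

(** (R1) at [f u] minus [f] times (R1) at [u].  On the left, the products of
    pairings with [D f] add up to [delta_met s t u] times [D f]; the same term
    comes on the right from the derivation rule for [D], and cancels.  Pairing
    with [w] turns an identity of sections into one in a commutative ring. *)
Lemma anchor_defect_pair s t f u w :
  anchor_defect s t f * <| u, w |> =
  <| s, u |> * <| cD_defect t f, w |> - <| t, u |> * <| cD_defect s f, w |>.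
Proof.
have amulDr a b c : a ** (b + c) = a ** b + a ** c by exact: linearDr.
have amulBr a b c : a ** (b - c) = a ** b - a ** c by exact: linearBr.
have DD (h k : smoothFun M) : D (h + k) = D h + D k by exact: linearD.
have DB (h k : smoothFun M) : D (h - k) = D h - D k by exact: linearB.
have E1 := congr1 (fun v => <| v, w |>) (courant_R1 s t u).
have E2 := congr1 (fun v => <| v, w |>) (courant_R1 s t (fscale f u)).
(* Keep the value folded in E1 and E2, and its expansion aside. *)
have Ed : delta_met (cmet C) s t u = delta_met (cmet C) s t u by [].
rewrite {2}/delta_met in Ed.
move: E1 E2; rewrite delta_met_fscale; move: (delta_met _ _ _ _) Ed => d Ed.
rewrite /associator !(courant_leibniz _ _ f) !(amulBr, amulDr) !courant_leibniz.
rewrite !(DB, DD) !cD_cocycle /anchor_defect /cD_defect.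
rewrite !(pairBl, pairDl, pairZl) => E1 E2.
(* The difference of the two sides below is the combination
   E2 - f * E1 + Ed * <D f, w> of these three equations. *)
have H (a1 b1 a2 b2 a3 b3 k : smoothFun M) : a1 = b1 -> a2 = b2 -> a3 = b3 ->
  a2 - b2 - f * (a1 - b1) + (a3 - b3) * k = 0.
  by move=> -> -> ->; ring.
by apply/subr0_eq; rewrite -(H _ _ _ _ _ _ <| D f, w |> E1 E2 Ed); ring.
Qed.

End courant.

Theorem theorem7p2 (R : realType) (n : nat) (M : smoothManifold R n)
    (C : nonAsymmetricCourant M)
    (hM : connected [set: M]) (hC : (2 < vbrank C)%N)
    (s s' : section C) :
  is_lie_bracket (rho s) (rho s') (rho (amul C s s') - rho (amul C s' s)).
Proof.
move=> f; rewrite vactB; apply/esym/subr0_eq; rewrite -/(anchor_defect s s' f).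
apply: smoothFun_eq => x.
have [u u0 [su s'u]] := exists_orthogonal (cmet C) (s x) (s' x) hC.
(* A vector that does not pair to zero with u, to recover the defect from its
   product with u. *)
have [v guv] : exists v, cmet C x u v != 0.
  apply/not_existsP => uv; move/eqP: u0; apply.
  by apply: met_nondeg => v; apply/eqP; apply/negPn/negP; exact: uv.
have [U Ux] := section_through u.
have [W Wx] := section_through v.
have /(congr1 (fun h : smoothFun M => h x)) /= := anchor_defect_pair s s' f U W.
rewrite Ux Wx su s'u !mul0r mulr0 addr0.
by move/eqP; rewrite mulf_eq0 (negPf guv) orbF => /eqP.
Qed.
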